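(* There is an absolute constant $K>0$ such that the following holds. For all integers $m\ge n\ge 1$ and all distributions $F_B,F_S$ on $\mathbb{R}$ with $r:=\Pr_{b\sim F_B,s\sim F_S}[b\ge s]\in(0,1)$ (with $b,s$ independent), there exists an integer $c$ with $0\le c\le K\left(1+\frac{\log(m/n)+\log(1/r)}{r}\right)$ such that the expected gains from trade of the Seller Trade Reduction mechanism on $m+c$ buyers with values i.i.d. from $F_B$ and $n+c$ sellers with values i.i.d. from $F_S$ is at least the expected first-best gains from trade with $m$ buyers with values i.i.d. from $F_B$ and $n$ sellers with values i.i.d. from $F_S$, i.e. $\mathrm{STR}(m+c,n+c)\ge\mathrm{OPT}(m,n)$.
   Context: Double auction: unit-demand buyers with values i.i.d. from $F_B$, unit-supply sellers (each holding one identical item) with values i.i.d. from $F_S$, all independent. Given buyer values $b^{(1)}\ge\dots\ge b^{(m)}$ and seller values $s^{(1)}\le\dots\le s^{(n)}$, let $r^*=\max\{i\le\min(m,n): b^{(i)}\ge s^{(i)}\}$ ($r^*=0$ if none). The first-best allocation trades the $r^*$ highest buyers with the $r^*$ lowest sellers, with gains from trade $\sum_{i=1}^{r^*}(b^{(i)}-s^{(i)})$; $\mathrm{OPT}(m,n)$ is its expectation. Seller Trade Reduction: with $s^{(n+1)}=\infty$, if $b^{(r^* )}\ge s^{(r^*+1)}$ the $r^*$ highest buyers trade with the $r^*$ lowest sellers; otherwise only the $r^*-1$ highest buyers trade with the $r^*-1$ lowest sellers. Gains from trade is the sum of traded buyers' values minus traded sellers' values; $\mathrm{STR}(m,n)$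 is its expectation. *)

(* Defs.v *)
From HB Require Import structures.
From mathcomp Require Import all_boot all_order all_algebra.
From mathcomp Require Import all_classical all_reals all_analysis.
Set Implicit Arguments. Unset Strict Implicit. Unset Printing Implicit Defensive.
Import Order.TTheory GRing.Theory Num.Theory.
Local Open Scope ring_scope.

Section DoubleAuction.
Variable R : realType.

Definition sort_desc (b : seq R) : seq R := sort (fun x y => y <= x) b.
Definition sort_asc (s : seq R) : seq R := sort (fun x y => x <= y) s.

(* rstar = max { i <= min(m,n) : b^(i) >= s^(i) } (1-indexed), 0 if none.
   With 0-indexed lists bs, ss: index i (0-based) corresponds to i.+1. *)
Definition rstar (b s : seq R) : nat :=
  let bs := sort_desc b in let ss := sort_asc s in
  \max_(i < minn (size b) (size s) | ss`_i <= bs`_i) i.+1.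

Definition gft_k (b s : seq R) (k : nat) : R :=
  \sum_(i < k) ((sort_desc b)`_i - (sort_asc s)`_i).

Definition gft_opt (b s : seq R) : R := gft_k b s (rstar b s).

(* number of trades under Seller Trade Reduction, with s^(n+1) = +infinity:
   rstar trades if b^(rstar) >= s^(rstar+1), otherwise rstar - 1 trades. *)
Definition str_trades (b s : seq R) : nat :=
  let r := rstar b s in
  if r is r'.+1 then
    (if ((r < size s)%N) && ((sort_asc s)`_r <= (sort_desc b)`_r') then r else r')
  else 0.

Definition gft_str (b s : seq R) : R := gft_k b s (str_trades b s).

Fixpoint iter_expect (P : probability R R) (k : nat) (f : seq R -> \bar R)
  : \bar R :=
  match k with
  | 0 => f [::]
  | k'.+1 => (\int[P]_x iter_expect P k' (fun xs => f (x :: xs)))%E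
  end.

Definition expect_auction (FB FS : probability R R) (m n : nat)
  (g : seq R -> seq R -> R) : \bar R :=
  iter_expect FB m (fun b => iter_expect FS n (fun s => (g b s)%:E)).

Definition OPT (FB FS : probability R R) (m n : nat) : \bar R :=
  expect_auction FB FS m n gft_opt.

Definition STR (FB FS : probability R R) (m n : nat) : \bar R :=
  expect_auction FB FS m n gft_str.

Definition prob_b_ge_s (FB FS : probability R R) : \bar R :=
  ((FB \x FS) [set p : R * R | (p.2 <= p.1)%R])%E.

End DoubleAuction.

(* Main.v *)
Require Import Defs.
From HB Require Import structures.
From mathcomp Require Import all_boot all_order all_algebra.
From mathcomp Require Import all_classical all_reals all_analysis.
From mathcomp Require Import measurable_realfun.
From mathcomp Require Import ring lra zify.
Set Implicit Arguments. Unset Strict Implicit. Unset Printing Implicit Defensive.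
Import Order.TTheory GRing.Theory Num.Theory.
Local Open Scope ring_scope.

(* Put M = m + c, N = n + c and let q be the number of efficient trades of the
   augmented market.  By exchangeability the original market is a uniformly placed
   window of the augmented one.  At a competitive price the efficient gains are the
   sum of the agents' surpluses, and they bound the gains of every submarket from
   above; so passing to a random window loses a fraction c/M of the buyers' and c/N
   of the sellers' surplus.  The mechanism drops one trade, of value delta, only if
   the dropped buyer's value is a competitive price, and at that price the sellers'
   surplus is at least q delta.  Hence the mechanism on the augmented market beats
   the average window, with a margin proportional to (b_0 - s_0)^+, whenever
   q >= 2N/c.  Otherwise the loss is at most the sum of all (b_i - s_j)^+.  Among
   the N independent pairs (b_i, s_i) at most 2q trade, so the event q < t has
   indicator at most 4^t times the product of 1/2 over trading pairs; leaving out
   one pair makes this independent of that pair's gain and yields the factor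
   4^t (1 - r/2)^(N-1), which is negligible against the margin once
   c r >= 128 (1 + log(m/n) + log(1/r)). *)

(** * Order statistics and competitive prices *)

Section Combinatorics.
Variable R : realType.
Implicit Types (b s l : seq R) (x y p : R) (f : R -> R).

Lemma size_sort_desc b : size (sort_desc b) = size b.
Proof. exact: size_sort. Qed.

Lemma size_sort_asc s : size (sort_asc s) = size s.
Proof. exact: size_sort. Qed.

Lemma sort_desc_nth b i j : (i <= j)%N -> (j < size b)%N ->
  (sort_desc b)`_j <= (sort_desc b)`_i.
Proof.
move=> ij jb; have ib := leq_ltn_trans ij jb.
have tr : transitive (fun x y : R => y <= x).
  by move=> y x z yx zy; exact: le_trans zy yx.
have so : sorted (fun x y : R => y <= x) (sort_desc b).
  by apply: sort_sorted => x y; exact: le_total.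
by apply: (sorted_leq_nth tr _ 0 so) => //; rewrite inE size_sort_desc.
Qed.

Lemma sort_asc_nth s i j : (i <= j)%N -> (j < size s)%N ->
  (sort_asc s)`_i <= (sort_asc s)`_j.
Proof.
move=> ij jb; have ib := leq_ltn_trans ij jb.
have so : sorted (fun x y : R => x <= y) (sort_asc s).
  by apply: sort_sorted => x y; exact: le_total.
by apply: (sorted_leq_nth le_trans _ 0 so) => //; rewrite inE size_sort_asc.
Qed.

Lemma sort_desc_perm b b' : perm_eq b b' -> sort_desc b = sort_desc b'.
Proof.
move=> bb'; apply/perm_sortP => //.
- by move=> x y; exact: le_total.
- by move=> y x z yx zy; exact: le_trans zy yx.
- by move=> x y /andP[yx xy]; apply/le_anti/andP.
Qed.

Lemma sort_asc_perm s s' : perm_eq s s' -> sort_asc s = sort_asc s'.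
Proof.
move=> ss'; apply/perm_sortP => //.
- by move=> x y; exact: le_total.
- exact: le_trans.
- exact: le_anti.
Qed.

Lemma sort_descE b : sort_desc b = rev (sort_asc b).
Proof.
apply: (@sorted_eq _ (fun x y : R => y <= x)).
- by move=> y x z yx zy; exact: le_trans zy yx.
- by move=> x y /andP[yx xy]; apply/le_anti/andP.
- by apply: sort_sorted => x y; exact: le_total.
- by rewrite rev_sorted; apply: sort_sorted => x y; exact: le_total.
- by rewrite perm_sym perm_rev perm_sym /sort_desc /sort_asc !perm_sort perm_sym perm_sort.
Qed.

Lemma rstar_perm b b' s s' : perm_eq b b' -> perm_eq s s' ->
  rstar b s = rstar b' s'.
Proof.
move=> bb' ss'; rewrite /rstar (sort_desc_perm bb') (sort_asc_perm ss').
by rewrite (perm_size bb') (perm_size ss').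
Qed.

Lemma rstar_le b s : (rstar b s <= minn (size b) (size s))%N.
Proof. by apply/bigmax_leqP => i _; exact: ltn_ord. Qed.

Lemma rstar_last b s : (0 < rstar b s)%N ->
  (sort_asc s)`_(rstar b s).-1 <= (sort_desc b)`_(rstar b s).-1.
Proof.
rewrite /rstar /=; elim/big_ind: _ => // i j hi hj.
by rewrite /maxn; case: ifP.
Qed.

Lemma rstar_max b s i : (i < minn (size b) (size s))%N ->
  (rstar b s <= i)%N -> (sort_desc b)`_i < (sort_asc s)`_i.
Proof.
move=> ik; rewrite leqNgt ltNge; apply: contraNN => le_i.
rewrite /rstar /=.
exact: (@leq_bigmax_cond _ (fun j : 'I_(minn (size b) (size s)) =>
   (sort_asc s)`_j <= (sort_desc b)`_j) (fun j => j.+1) (Ordinal ik)).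
Qed.

(** * Duality between gains from trade and surpluses at a uniform price *)

Lemma big_seq_nth l f : \sum_(x <- l) f x = \sum_(i < size l) f l`_i.
Proof. by rewrite (big_nth 0) big_mkord. Qed.

Lemma sum_nth_le l k f : (forall x, 0 <= f x) -> (k <= size l)%N ->
  \sum_(i < k) f l`_i <= \sum_(x <- l) f x.
Proof.
move=> f0 kl; rewrite big_seq_nth (big_ord_widen _ (fun i => f l`_i) kl).
by rewrite big_mkcond /=; apply: ler_sum => i _; case: ifP.
Qed.

Lemma sum_pos_prefix l q f : (q <= size l)%N ->
  (forall i, (i < q)%N -> 0 <= f l`_i) ->
  (forall i, (q <= i < size l)%N -> f l`_i <= 0) ->
  \sum_(x <- l) Num.max 0 (f x) = \sum_(i < q) f l`_i.
Proof.
move=> ql h1 h2; rewrite (big_seq_nth l (fun x => Num.max 0 (f x))).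
rewrite (big_ord_widen _ (fun i => f l`_i) ql) [RHS]big_mkcond /=.
apply: eq_bigr => i _; case: ifPn => [/h1 /max_r //|].
by rewrite -leqNgt => qi; apply/max_l/h2; rewrite qi ltn_ord.
Qed.

Lemma sum_sort_desc b f : \sum_(x <- sort_desc b) f x = \sum_(x <- b) f x.
Proof. by apply: perm_big; rewrite perm_sort. Qed.

Lemma sum_sort_asc s f : \sum_(x <- sort_asc s) f x = \sum_(x <- s) f x.
Proof. by apply: perm_big; rewrite perm_sort. Qed.

Lemma gft_kE b s p k : gft_k b s k =
  \sum_(i < k) ((sort_desc b)`_i - p) + \sum_(i < k) (p - (sort_asc s)`_i).
Proof.
by rewrite /gft_k -big_split /=; apply: eq_bigr => i _; rewrite addrA subrK.
Qed.

(** The dual objective: what all agents gain when each may trade, or abstain, at the price [p]. *)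
Definition surplus b s p : R :=
  \sum_(x <- b) Num.max 0 (x - p) + \sum_(y <- s) Num.max 0 (p - y).

(** Weak duality: the price cancels within each trade, each half is at most its positive part, and
    untraded agents add nonnegative terms. *)
Lemma gft_k_le_surplus b s p k : (k <= size b)%N -> (k <= size s)%N ->
  gft_k b s k <= surplus b s p.
Proof.
move=> kb ks; rewrite (gft_kE _ _ p) /surplus.
rewrite -(sum_sort_desc b) -(sum_sort_asc s); apply: lerD.
- apply: le_trans (sum_nth_le (f := fun x => Num.max 0 (x - p)) _ _).
  + by apply: ler_sum => i _; rewrite le_max lexx orbT.
  + by move=> x; rewrite le_max lexx.
  + by rewrite size_sort_desc.
- apply: le_trans (sum_nth_le (f := fun x => Num.max 0 (p - x)) _ _).
  + by apply: ler_sum => i _; rewrite le_max lexx orbT.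
  + by move=> x; rewrite le_max lexx.
  + by rewrite size_sort_asc.
Qed.

Lemma gft_opt_le_surplus b s p : gft_opt b s <= surplus b s p.
Proof.
have := rstar_le b s; rewrite leq_min => /andP[? ?].
exact: gft_k_le_surplus.
Qed.

(** The price [p] clears the market with the first [q] sorted agents of each side trading. *)
Definition competitive b s q p :=
  [/\ forall i, (i < q)%N -> p <= (sort_desc b)`_i,
      forall i, (i < q)%N -> (sort_asc s)`_i <= p,
      forall i, (q <= i < size b)%N -> (sort_desc b)`_i <= p &
      forall i, (q <= i < size s)%N -> p <= (sort_asc s)`_i].

Lemma competitive_sums b s q p : (q <= size b)%N -> (q <= size s)%N ->
  competitive b s q p ->
  \sum_(x <- b) Num.max 0 (x - p) = \sum_(i < q) ((sort_desc b)`_i - p) /\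
  \sum_(y <- s) Num.max 0 (p - y) = \sum_(i < q) (p - (sort_asc s)`_i).
Proof.
move=> qb qs [h1 h2 h3 h4]; split.
- rewrite -(sum_sort_desc b); apply: (sum_pos_prefix (f := fun x => x - p)).
  + by rewrite size_sort_desc.
  + by move=> i iq; rewrite subr_ge0 h1.
  + by move=> i; rewrite size_sort_desc subr_le0 => ?; exact: h3.
- rewrite -(sum_sort_asc s); apply: (sum_pos_prefix (f := fun x => p - x)).
  + by rewrite size_sort_asc.
  + by move=> i iq; rewrite subr_ge0 h2.
  + by move=> i; rewrite size_sort_asc subr_le0 => ?; exact: h4.
Qed.

(** Strong duality: at a clearing price the positive parts vanish beyond rank [rstar b s] and are
    plain differences before it. *)
Lemma surplus_competitive b s p : competitive b s (rstar b s) p ->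
  surplus b s p = gft_opt b s.
Proof.
have := rstar_le b s; rewrite leq_min => /andP[qb qs] /(competitive_sums qb qs).
by rewrite /surplus /gft_opt (gft_kE _ _ p) => -[-> ->].
Qed.

(** * Averaging over cyclic windows *)

Lemma nth_rot l i j : (i < size l)%N -> (j < size l)%N ->
  (rot i l)`_j = l`_(if i + j < size l then i + j else i + j - size l)%N.
Proof.
move=> ul vl; rewrite /rot nth_cat size_drop nth_drop ltn_subRL.
case: ifPn => // uv.
have -> : (j - (size l - i) = i + j - size l)%N.
  by move: ul vl uv; move: (size l) => z; lia.
by rewrite nth_take//; move: ul vl uv; move: (size l) => z; lia.
Qed.

Lemma nth_rot_sym l i j : (i < size l)%N -> (j < size l)%N ->
  (rot i l)`_j = (rot j l)`_i.
Proof.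
by move=> il jl; rewrite !nth_rot// addnC.
Qed.

(** Position and shift enter a rotated index symmetrically, so each of the [k] window positions runs
    through all of [l] as the shift varies. *)
Lemma sum_rot_take l k f : (k <= size l)%N ->
  \sum_(a < size l) \sum_(x <- take k (rot a l)) f x = k%:R * \sum_(x <- l) f x.
Proof.
move=> kl.
transitivity (\sum_(a < size l) \sum_(i < k) f (rot a l)`_i).
  apply: eq_bigr => a _; rewrite big_seq_nth size_takel ?size_rot//.
  by apply: eq_bigr => i _; rewrite nth_take.
rewrite exchange_big /=.
transitivity (\sum_(i < k) \sum_(x <- l) f x); last first.
  by rewrite sumr_const card_ord mulr_natl.
apply: eq_bigr => i _.
transitivity (\sum_(x <- rot i l) f x); last by apply: perm_big; rewrite perm_rot.
rewrite big_seq_nth size_rot; apply: eq_bigr => a _.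
by rewrite nth_rot_sym// (leq_trans (ltn_ord i)).
Qed.

(** Weak duality in every window at one common price. The factor [size s] of the buyers' part counts
    the seller shifts, which do not affect it, and symmetrically for the sellers' part. *)
Lemma sum_windows_le b s m n p : (m <= size b)%N -> (n <= size s)%N ->
  \sum_(a < size b) \sum_(d < size s)
    gft_opt (take m (rot a b)) (take n (rot d s)) <=
  (size s)%:R * m%:R * (\sum_(x <- b) Num.max 0 (x - p)) +
  (size b)%:R * n%:R * (\sum_(y <- s) Num.max 0 (p - y)).
Proof.
move=> mb ns; rewrite -!mulrA -!sum_rot_take//.
apply: (@le_trans _ _ (\sum_(a < size b) \sum_(d < size s)
    (\sum_(x <- take m (rot a b)) Num.max 0 (x - p) +
     \sum_(y <- take n (rot d s)) Num.max 0 (p - y)))).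
  by apply: ler_sum => a _; apply: ler_sum => d _; exact: gft_opt_le_surplus.
rewrite le_eqVlt; apply/orP; left; apply/eqP.
under eq_bigr do rewrite big_split /= sumr_const card_ord.
by rewrite big_split /= sumr_const card_ord sumrMnl !mulr_natl.
Qed.

(* When the mechanism drops a trade, the value of the dropped buyer is itself a
   competitive price: this is what makes a missing seller pay for the loss. *)
Lemma str_reduction b s (q := rstar b s) : (size s <= size b)%N ->
  (exists2 p, competitive b s q p & gft_str b s = gft_opt b s) \/
  [/\ (0 < q)%N, competitive b s q (sort_desc b)`_q.-1 &
      gft_str b s = gft_opt b s - ((sort_desc b)`_q.-1 - (sort_asc s)`_q.-1)].
Proof.
move=> sb.
have := rstar_le b s; have qlast := @rstar_last b s; have qmax := @rstar_max b s.
rewrite /gft_str /gft_opt /str_trades -/q in qlast qmax *.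
have -> : minn (size b) (size s) = size s by apply/minn_idPr.
rewrite (minn_idPr sb) in qmax => qs; clearbody q.
case: q => [|q] in qlast qmax qs *.
  (* No efficient trade: the lowest seller value clears the market or, without sellers, the highest
     buyer value. *)
  left; have [s0|s0] := posnP (size s); last first.
    exists (sort_asc s)`_0 => //; split => // i.
    - move=> /andP[_ ib]; apply: le_trans (ltW (qmax 0%N s0 isT)).
      exact: sort_desc_nth.
    - by move=> /andP[_ ib]; exact: sort_asc_nth.
  exists (sort_desc b)`_0 => //; split => // i.
    by move=> /andP[_ ib]; exact: sort_desc_nth.
  by rewrite s0 => /andP[].
rewrite /=; case: ifPn => [/andP[qs' le_qq]|nred].
  (* No reduction: the first untraded seller sets the clearing price. *)
  left; exists (sort_asc s)`_q.+1 => //; split => i.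
  - by move=> iq; apply: le_trans le_qq _; apply: sort_desc_nth; lia.
  - by move=> iq; apply: sort_asc_nth => //; lia.
  - move=> /andP[qi ib]; apply: le_trans (ltW (qmax q.+1 qs' _)) => //.
    exact: sort_desc_nth.
  - by move=> /andP[qi ib]; exact: sort_asc_nth.
right; split => //; last by rewrite /gft_k big_ord_recr /= addrK.
rewrite /=; have qq := qlast isT; split => i.
- by move=> iq; apply: sort_desc_nth; lia.
- by move=> iq; apply: le_trans qq; apply: sort_asc_nth; lia.
- by move=> /andP[qi ib]; apply: sort_desc_nth; lia.
(* There is an untraded seller, so the part of the test that failed is the comparison: the last
   traded buyer is below every untraded seller. *)
- move=> /andP[qi ib]; move: nred; have -> /= : (q.+1 < size s)%N by lia.
  by rewrite -ltNge => /ltW /le_trans; apply; apply: sort_asc_nth; lia.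
Qed.

(** The price cancels between buyer 0 and seller 0. This bound is the source of the margin. *)
Lemma max0_le_surplus b s p : (0 < size b)%N -> (0 < size s)%N ->
  Num.max 0 (b`_0 - s`_0) <= surplus b s p.
Proof.
case: b s => [//|x b] [//|y s] _ _; rewrite /surplus !big_cons /=.
have hb : 0 <= \sum_(j <- b) Num.max 0 (j - p).
  by apply: sumr_ge0 => j _; rewrite le_max lexx.
have hs : 0 <= \sum_(j <- s) Num.max 0 (p - j).
  by apply: sumr_ge0 => j _; rewrite le_max lexx.
have [? ?] : x - p <= Num.max 0 (x - p) /\ p - y <= Num.max 0 (p - y).
  by rewrite !le_max !lexx !orbT.
have [? ?] : 0 <= Num.max 0 (x - p) /\ 0 <= Num.max 0 (p - y).
  by rewrite !le_max !lexx.
by rewrite ge_max; apply/andP; split; lra.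
Qed.

(** Replaces a pair at data-dependent positions by a sum over front pairs: the rotations by [i] and
    [j] contribute it, and all other terms are nonnegative. *)
Lemma nth_diff_le_sum_rot b s i j : (i < size b)%N -> (j < size s)%N ->
  b`_i - s`_j <= \sum_(a < size b) \sum_(d < size s)
                  Num.max 0 ((rot a b)`_0 - (rot d s)`_0).
Proof.
move=> ib js.
have b0 := leq_ltn_trans (leq0n _) ib; have s0 := leq_ltn_trans (leq0n _) js.
rewrite (bigD1 (Ordinal ib)) //= (bigD1 (Ordinal js)) //=.
rewrite !(@nth_rot_sym _ _ 0%N)// !rot0.
have h1 : 0 <= \sum_(d < size s | d != Ordinal js)
   Num.max 0 (b`_i - (rot d s)`_0).
  by apply: sumr_ge0 => d _; rewrite le_max lexx.
have h2 : 0 <= \sum_(a < size b | a != Ordinal ib) \sum_(d < size s)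
   Num.max 0 ((rot a b)`_0 - (rot d s)`_0).
  by apply: sumr_ge0 => a _; apply: sumr_ge0 => d _; rewrite le_max lexx.
have h3 : b`_i - s`_j <= Num.max 0 (b`_i - s`_j) by rewrite le_max lexx orbT.
by lra.
Qed.

(* Summing over all cyclic windows of [m] of the [M] buyers and [n] of the [N]
   sellers averages the original market over positions in the augmented one.  At a
   competitive price [p], a window keeps on average a fraction [m/M] of the buyers'
   surplus and [n/N] of the sellers' surplus [B].  If a trade of value [delta] is
   dropped at price [p], then [q * delta <= B], so [q >= t] gives
   [(c / N) * B / 2 >= delta]; for [q < t] the loss is paid by the last term. *)
Lemma gft_windows_le_str b s m n c t (M := (m + c)%N) (N := (n + c)%N) :
  (0 < n)%N -> (n <= m)%N -> (2 * N <= c * t)%N ->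
  size b = M -> size s = N ->
  \sum_(a < M) \sum_(d < N) gft_opt (take m (rot a b)) (take n (rot d s)) +
    N%:R * c%:R / 2 * Num.max 0 (b`_0 - s`_0) <=
  M%:R * N%:R * gft_str b s + M%:R * N%:R *
    \sum_(a < M) \sum_(d < N) (rstar b s < t)%:R *
       Num.max 0 ((rot a b)`_0 - (rot d s)`_0).
Proof.
move=> n0 nm Nct bM sN.
have mb : (m <= size b)%N by rewrite bM leq_addr.
have ns : (n <= size s)%N by rewrite sN leq_addr.
have b0 : (0 < size b)%N by rewrite bM /M; lia.
have s0 : (0 < size s)%N by rewrite sN /N; lia.
have sb : (size s <= size b)%N by rewrite bM sN /M /N; lia.
under [X in _ <= _ + _ * X]eq_bigr do rewrite -mulr_sumr.
rewrite -mulr_sumr.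
move: (fun p => @sum_windows_le b s m n p mb ns); rewrite bM sN => win.
have := rstar_le b s; rewrite leq_min => /andP[qb qs].
(* Order statistics are entries of the samples, so the sum over rotations dominates the value of any
   dropped trade. *)
have Zle i j : (i < M)%N -> (j < N)%N -> (sort_desc b)`_i - (sort_asc s)`_j <=
    \sum_(a < M) \sum_(d < N) Num.max 0 ((rot a b)`_0 - (rot d s)`_0).
  move=> iM jN.
  have : (sort_desc b)`_i \in b.
    by rewrite -(mem_sort (fun x y : R => y <= x)) mem_nth// size_sort_desc bM.
  move=> /(nthP 0)[i' i'b <-].
  have : (sort_asc s)`_j \in s.
    by rewrite -(mem_sort (fun x y : R => x <= y)) mem_nth// size_sort_asc sN.
  move=> /(nthP 0)[j' j's <-].
  by rewrite -bM -sN; exact: nth_diff_le_sum_rot.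
set Z := \sum_(a < M) _ in Zle *.
set W := \sum_(a < M) _ in win *.
set h := Num.max 0 _.
have Z0 : 0 <= Z.
  by apply: sumr_ge0 => a _; apply: sumr_ge0 => d _; rewrite le_max lexx.
have h0 : 0 <= h by rewrite le_max lexx.
have EM : M%:R = m%:R + c%:R :> R by rewrite natrD.
have EN : N%:R = n%:R + c%:R :> R by rewrite natrD.
have c0 : 0 <= c%:R :> R by [].
have n0' : 0 <= n%:R :> R by [].
have nm' : n%:R <= m%:R :> R by rewrite ler_nat.
(* With [A] and [B] the buyers' and sellers' surplus, the windows lose at least [N c A + M c B].
   Since [N <= M] and [h <= A + B], this pays the margin [N c h / 2] and leaves [M c B / 2] for a
   dropped trade. *)
have key p : competitive b s (rstar b s) p ->
   let B := \sum_(y <- s) Num.max 0 (p - y) in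
   [/\ 0 <= B & W + N%:R * c%:R / 2 * h + M%:R * c%:R / 2 * B <=
      M%:R * N%:R * gft_opt b s].
  move=> comp B; have := win p.
  have := max0_le_surplus p b0 s0; rewrite (surplus_competitive comp) -/h.
  rewrite -(surplus_competitive comp) /surplus -/B.
  have A0 : 0 <= \sum_(x <- b) Num.max 0 (x - p).
    by apply: sumr_ge0 => a _; rewrite le_max lexx.
  have B0 : 0 <= B by apply: sumr_ge0 => a _; rewrite le_max lexx.
  set A := \sum_(x <- b) _ in A0 * => hAB WAB.
  split => //.
  have Nc0 : 0 <= N%:R * c%:R / 2 :> R by rewrite divr_ge0// mulr_ge0.
  have := ler_wpM2l Nc0 hAB.
  have : 0 <= c%:R * (m%:R - n%:R) * A :> R by rewrite !mulr_ge0// subr_ge0.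
  have : 0 <= c%:R * (m%:R - n%:R) * B :> R by rewrite !mulr_ge0// subr_ge0.
  have : 0 <= c%:R * N%:R * A :> R by rewrite !mulr_ge0.
  have : 0 <= c%:R * N%:R * B :> R by rewrite !mulr_ge0.
  move: WAB; rewrite EM EN; lra.
have MN0 : 0 <= M%:R * N%:R :> R by rewrite mulr_ge0.
have [[p comp ->]|[q0 comp ->]] := str_reduction sb.
  have [B0 {}key] := key _ comp.
  apply: le_trans (_ : _ <= M%:R * N%:R * gft_opt b s) _; last first.
    by rewrite lerDl mulr_ge0// mulr_ge0.
  apply: le_trans key; rewrite lerDl mulr_ge0// divr_ge0// mulr_ge0//.
have [B0 {}key] := key _ comp.
have [_ BE] := competitive_sums qb qs comp.
set q := rstar b s in q0 qb qs comp BE B0 key *.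
set p := (sort_desc b)`_q.-1 in comp B0 key BE *.
set B := \sum_(y <- s) _ in B0 key BE.
have [qt|tq] := ltnP q t.
  rewrite mul1r; have : p - (sort_asc s)`_q.-1 <= Z by apply: Zle; lia.
  have : 0 <= M%:R * c%:R / 2 * B by rewrite mulr_ge0// divr_ge0// mulr_ge0.
  move=> h1 /(ler_wpM2l MN0); rewrite mulrBr; lra.
rewrite mul0r mulr0 addr0; set del := p - _.
have qB : q%:R * del <= B.
  rewrite BE -[q in q%:R]card_ord mulr_natl -sumr_const; apply: ler_sum => i _.
  by rewrite lerD2l lerN2; apply: sort_asc_nth; have := ltn_ord i; lia.
have del0 : 0 <= del by rewrite subr_ge0; exact: rstar_last.
have cq : 2 * N%:R <= c%:R * q%:R :> R.
  by rewrite -!natrM ler_nat (leq_trans Nct)// leq_mul2l tq orbT.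
have : M%:R * N%:R * del <= M%:R * c%:R / 2 * B.
  apply: (@le_trans _ _ (M%:R * c%:R / 2 * (q%:R * del))).
    rewrite (_ : _ / 2 * _ = M%:R * ((c%:R * q%:R) / 2) * del); last by ring.
    by rewrite ler_wpM2r// ler_wpM2l//; lra.
  by rewrite ler_wpM2l// divr_ge0// mulr_ge0.
rewrite (mulrBr _ (gft_opt b s)); lra.
Qed.

(** * Few efficient trades force few trading pairs *)

Lemma count_sorted_asc s k : (count (fun y => (y < (sort_asc s)`_k)%R) s <= k)%N.
Proof.
(* Past the end [nth] returns 0, but the count never exceeds the size. Otherwise only the first [k]
   sorted entries can lie strictly below entry [k]. *)
have [ks|sk] := ltnP k (size s); last exact: leq_trans (count_size _ _) sk.
have /permP <- : perm_eq (sort_asc s) s by rewrite perm_sort.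
rewrite -[X in count _ X](cat_take_drop k) count_cat.
have -> : count (fun y => (y < (sort_asc s)`_k)%R) (drop k (sort_asc s)) = 0%N.
  apply/eqP; rewrite -leqn0 leqNgt -has_count -all_predC; apply/(all_nthP 0) => i.
  rewrite size_drop size_sort_asc nth_drop /= -leNgt => ?.
  by apply: sort_asc_nth; lia.
by rewrite addn0 (leq_trans (count_size _ _))// size_take_min geq_minl.
Qed.

Lemma count_sorted_desc b k : (count (fun x => ((sort_desc b)`_k < x)%R) b <= k)%N.
Proof.
have [ks|sk] := ltnP k (size b); last exact: leq_trans (count_size _ _) sk.
have /permP <- : perm_eq (sort_desc b) b by rewrite perm_sort.
rewrite -[X in count _ X](cat_take_drop k) count_cat.
have -> : count (fun x => ((sort_desc b)`_k < x)%R) (drop k (sort_desc b)) = 0%N.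
  apply/eqP; rewrite -leqn0 leqNgt -has_count -all_predC; apply/(all_nthP 0) => i.
  rewrite size_drop size_sort_desc nth_drop /= -leNgt => ?.
  by apply: sort_desc_nth; lia.
by rewrite addn0 (leq_trans (count_size _ _))// size_take_min geq_minl.
Qed.

Lemma sum_nat_count l (P : pred R) :
  (\sum_(i < size l) P (l`_i)%R)%N = count P l.
Proof.
rewrite -sum1_count (big_nth 0) big_mkord [RHS]big_mkcond /=.
by apply: eq_bigr => i _; case: (P _).
Qed.

(* The r* efficient trades need not be a largest matching, hence the factor 2:
   a pair with s_i <= b_i has s_i or b_i beyond the (r*+1)-st order statistics. *)
Lemma count_pairs_le_rstar b s : (size s <= size b)%N ->
  (\sum_(i < size s) (s`_i <= b`_i)%R <= 2 * rstar b s)%N.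
Proof.
move=> sb; set q := rstar b s.
have [qs|sq] := ltnP q (size s); last first.
  apply: (@leq_trans (\sum_(i < size s) 1)).
    by apply: leq_sum => i _; case: (_ <= _).
  by rewrite sum1_card card_ord; lia.
have qmax : (sort_desc b)`_q < (sort_asc s)`_q.
  by apply: rstar_max => //; rewrite (minn_idPr sb).
rewrite mul2n -addnn.
apply: leq_trans (leq_add (count_sorted_asc s q) (count_sorted_desc b q)).
rewrite -!sum_nat_count (big_ord_widen _ (fun i => (s`_i <= b`_i)%R : nat) sb).
rewrite (big_ord_widen _ (fun i => (s`_i < (sort_asc s)`_q)%R : nat) sb).
rewrite big_mkcond [X in (_ <= X + _)%N]big_mkcond /= -big_split /=; apply: leq_sum => i _.
case: ifP => // _.
have [] := ltP s`_i (sort_asc s)`_q; have [] := ltP (sort_desc b)`_q b`_i;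
  have [] := leP s`_i b`_i => //.
by move=> h1 h2 h3; have := lt_le_trans qmax (le_trans h3 (le_trans h1 h2)); rewrite ltxx.
Qed.

(** Three choices occur: [1/2, 1] for an exponential moment of the number of trading pairs, [1, 0]
    for the indicator of a trade, and [1, 1] for no weighting. *)
Definition pair_weight u v x y : R := if y <= x then u else v.

(** An exponential Markov bound: fewer than [t] efficient trades leave at most [2 t] trading pairs,
    so the product is at least [4 ^- t]. Omitting pair 0 can only lower the count. *)
Lemma rstar_lt_le_prod b s t : (size s <= size b)%N ->
  (rstar b s < t)%:R <= 4 ^+ t *
    \prod_(i < (size s).-1) pair_weight 2^-1 1 b`_i.+1 s`_i.+1.
Proof.
move=> sb.
have P0 : 0 <= \prod_(i < (size s).-1) pair_weight 2^-1 1 b`_i.+1 s`_i.+1.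
  by apply: prodr_ge0 => i _; rewrite /pair_weight; case: ifP.
have [qt|_] := ltnP (rstar b s) t; last by rewrite mulr_ge0// exprn_ge0.
rewrite (eq_bigr (fun i : 'I_(size s).-1 => 2^-1 ^+ (s`_i.+1 <= b`_i.+1)%R)); last first.
  by move=> i _; rewrite /pair_weight; case: ifP.
rewrite -expr_sum; set cnt := (\sum_(i < _) _)%N.
have : (cnt <= 2 * t)%N.
  apply: leq_trans (leq_trans (count_pairs_le_rstar sb) _); last by lia.
  rewrite /cnt; case: s {sb P0 qt cnt} => [|y s]; first by rewrite big_ord0.
  by rewrite [leqRHS]big_ord_recl /= leq_addl.
move=> /(ler_wiXn2l (x := 2^-1 : R)) h.
apply: (@le_trans _ _ (4 ^+ t * 2^-1 ^+ (2 * t))).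
  rewrite exprM -exprMn expr2 (_ : 4 * _ = 1) ?expr1n//; lra.
by rewrite ler_wpM2l ?exprn_ge0// h//; lra.
Qed.

(** * Lower bounds on the mechanism's gains *)

Lemma last_trade_le_nth b s i : (i < rstar b s)%N ->
  (sort_desc b)`_(rstar b s).-1 - (sort_asc s)`_(rstar b s).-1 <=
  (sort_desc b)`_i - (sort_asc s)`_i.
Proof.
move=> iq; have := rstar_le b s; rewrite leq_min => /andP[qb qs].
by apply: lerB; [apply: sort_desc_nth|apply: sort_asc_nth]; lia.
Qed.

Lemma gft_k_ge0 b s k : (k <= rstar b s)%N -> 0 <= gft_k b s k.
Proof.
move=> kq; apply: sumr_ge0 => i _.
have iq : (i < rstar b s)%N by apply: leq_trans kq.
apply: le_trans (last_trade_le_nth iq); rewrite subr_ge0; apply: rstar_last.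
exact: leq_ltn_trans iq.
Qed.

Lemma gft_opt_ge0 b s : 0 <= gft_opt b s.
Proof. exact: gft_k_ge0. Qed.

Lemma gft_str_ge0 b s : 0 <= gft_str b s.
Proof.
apply: gft_k_ge0; rewrite /str_trades.
by case: (rstar b s) => // q; case: ifP.
Qed.

(** A dropped trade is the least valuable of at least two. *)
Lemma gft_str_ge_half b s : (size s <= size b)%N -> (2 <= rstar b s)%N ->
  gft_opt b s / 2 <= gft_str b s.
Proof.
move=> sb q2; have o0 := gft_opt_ge0 b s.
case: (str_reduction sb) => [[p _ ->]|[q0 _ ->]]; first by lra.
set del := _`_(rstar b s).-1 - _.
have del0 : 0 <= del by rewrite subr_ge0; exact: rstar_last.
have : (rstar b s)%:R * del <= gft_opt b s.
  rewrite -[rstar b s in X in X <= _]card_ord mulr_natl -sumr_const.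
  by apply: ler_sum => i _; exact: last_trade_le_nth.
have : 2 * del <= (rstar b s)%:R * del by rewrite ler_wpM2r// ler_nat.
by lra.
Qed.

(** The product vanishes unless all pairs after pair 0 trade. There are at least three of them, so
    [count_pairs_le_rstar] gives two efficient trades, and half of the efficient gains survives. *)
Lemma gft_str_ge_prod b s : (3 < size s)%N -> (size s <= size b)%N ->
  2^-1 * (Num.max 0 (b`_0 - s`_0) *
    \prod_(i < (size s).-1) pair_weight 1 0 b`_i.+1 s`_i.+1) <=
  gft_str b s.
Proof.
move=> s3 sb.
have [/forallP h|] := boolP [forall i : 'I_(size s).-1, s`_i.+1 <= b`_i.+1]; last first.
  rewrite negb_forall => /existsP[i /negbTE hi].
  by rewrite (bigD1 i)//= /pair_weight hi mul0r !mulr0 gft_str_ge0.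
rewrite big1 ?mulr1; last by move=> i _; rewrite /pair_weight h.
apply: le_trans (gft_str_ge_half sb _).
  rewrite mulrC ler_pM2r; last by lra.
  have [p comp] : exists p, competitive b s (rstar b s) p.
    by case: (str_reduction sb) => [[p ? _]|[_ ? _]]; eexists; eassumption.
  by rewrite -(surplus_competitive comp) max0_le_surplus//; lia.
have := count_pairs_le_rstar sb.
have : ((size s).-1 <= \sum_(i < size s) (s`_i <= b`_i)%R)%N.
  case: s h {s3 sb} => [|y s] h; first by rewrite big_ord0.
  rewrite big_ord_recl /= -[X in (X <= _)%N]card_ord -sum1_card.
  by rewrite (leq_trans _ (leq_addl _ _))//; apply: leq_sum => i _; rewrite (h i).
by lia.
Qed.

End Combinatorics.

(** * Measurability *)

Section Measurability.
Local Open Scope classical_set_scope.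
Variable R : realType.

Lemma measurable_nth k i :
  measurable_fun [set: k.-tuple R] (fun t : k.-tuple R => t`_i).
Proof.
have [ik|ki] := ltnP i k.
  apply: eq_measurable_fun (measurable_tnth (Ordinal ik)) => t _.
  by rewrite (tnth_nth 0).
apply: eq_measurable_fun (measurable_cst (0 : R)) => t _.
by rewrite nth_default// size_tuple.
Qed.

Lemma measurable_mktuple d (T : measurableType d) k (f : 'I_k -> T -> R) :
  (forall i, measurable_fun [set: T] (f i)) ->
  measurable_fun [set: T] (fun t => [tuple f i t | i < k]).
Proof.
move=> mf; apply/measurable_fun_tnthP => i.
by apply: eq_measurable_fun (mf i) => t _ /=; rewrite tnth_mktuple.
Qed.

Lemma measurable_rot k a : (a < k)%N ->
  measurable_fun [set: k.-tuple R] (fun t : k.-tuple R => [tuple (rot a t)`_i | i < k]).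
Proof.
move=> ak; apply: measurable_mktuple => i.
apply: eq_measurable_fun
  (measurable_nth (k := k) (if a + i < k then a + i else a + i - k)%N) => t _.
by rewrite nth_rot size_tuple.
Qed.

Lemma measurable_take k m :
  measurable_fun [set: k.-tuple R] (fun t : k.-tuple R => [tuple (take m t)`_i | i < m]).
Proof.
apply: measurable_mktuple => i.
by apply: eq_measurable_fun (measurable_nth (k := k) i) => t _; rewrite nth_take.
Qed.

Lemma val_nth_tuple k (l : seq R) : size l = k -> [tuple l`_i | i < k] = l :> seq R.
Proof.
move=> lk; apply: (@eq_from_nth _ 0); first by rewrite size_tuple.
move=> i; rewrite size_tuple => ik.
by have := tnth_mktuple (fun j : 'I_k => l`_j) (Ordinal ik); rewrite (tnth_nth 0).
Qed.

(** The preimage splits into countably many pieces by the value of [k]. This treats gains whose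
    number of trades is random. *)
Lemma measurable_nat_dep d d' (T : measurableType d) (T' : measurableType d')
    (k : T -> nat) (F : nat -> T -> T') :
  measurable_fun [set: T] k -> (forall n, measurable_fun [set: T] (F n)) ->
  measurable_fun [set: T] (fun t => F (k t) t).
Proof.
move=> mk mF _ Y mY; rewrite setTI.
rewrite (_ : _ @^-1` Y = \bigcup_n (k @^-1` [set n] `&` F n @^-1` Y)); last first.
  apply/seteqP; split => t /=; first by exists (k t).
  by move=> [n _ [/= -> ]].
apply: bigcupT_measurable => n; apply: measurableI.
- by rewrite -[X in measurable X]setTI; exact: mk.
- by rewrite -[X in measurable X]setTI; exact: mF.
Qed.

Lemma measurable_bool_nat d (T : measurableType d) (f : T -> bool) :
  measurable_fun [set: T] f -> measurable_fun [set: T] (fun t => nat_of_bool (f t)).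
Proof.
move=> mf; have := measurable_fun_ifT mf (measurable_cst 1%N) (measurable_cst 0%N).
by apply: eq_measurable_fun => t _ /=; case: (f t).
Qed.

Lemma measurable_count k (P : R -> bool) : measurable_fun [set: R] P ->
  measurable_fun [set: k.-tuple R] (fun t : k.-tuple R => count P t).
Proof.
move=> mP.
apply: (@eq_measurable_fun _ _ _ _ _
    (fun t : k.-tuple R => \sum_(i <- index_enum 'I_k) P (t`_i)%R)%N) => [t _|].
  by rewrite -sum_nat_count size_tuple.
elim: (index_enum _) => [|i r IH].
  by under eq_fun do rewrite big_nil; exact: measurable_cst.
under eq_fun do rewrite big_cons; apply: measurable_fun_addn => //.
apply: measurable_bool_nat; apply: (measurableT_comp mP); exact: measurable_nth.
Qed.

(** Describes an order statistic by a count over the unsorted sample, so that measurability of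
    sorting reduces to that of counting. *)
Lemma sort_asc_count (s : seq R) i a : (i < size s)%N ->
  (a <= (sort_asc s)`_i) = (count (fun y => (y < a)%R) s <= i)%N.
Proof.
move=> is_; apply/idP/idP => [ai|].
  apply: leq_trans (count_sorted_asc s i); apply: sub_count => y ya.
  exact: lt_le_trans ya ai.
apply: contraTT; rewrite -ltNge -ltnNge => ia.
have /permP <- : perm_eq (sort_asc s) s by rewrite perm_sort.
rewrite -[X in count _ X](cat_take_drop i.+1) count_cat.
have sz : size (take i.+1 (sort_asc s)) = i.+1.
  by rewrite size_takel// size_sort_asc.
have /eqP -> : count (fun y => (y < a)%R) (take i.+1 (sort_asc s)) == i.+1.
  rewrite -[X in _ == X]sz -all_count; apply/(all_nthP 0) => j; rewrite sz => ji; rewrite nth_take//.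
  by apply: le_lt_trans ia; exact: sort_asc_nth.
by rewrite leq_addr.
Qed.

Lemma measurable_sort_asc k i :
  measurable_fun [set: k.-tuple R] (fun t : k.-tuple R => (sort_asc t)`_i).
Proof.
have [ik|ki] := ltnP i k; last first.
  apply: eq_measurable_fun (measurable_cst (0 : R)) => t _.
  by rewrite nth_default// size_sort_asc size_tuple.
move=> mT; apply: (measurability _ (RGenCInfty.measurableE R)) => //.
move=> /= _ [_ [a ->] <-]; rewrite setTI.
rewrite (_ : _ @^-1` _ = (fun t : k.-tuple R => count (fun y => (y < a)%R) t <= i)%N
   @^-1` [set true]); last first.
  apply/seteqP; split => t /=; rewrite in_itv /= andbT sort_asc_count ?size_tuple//.
rewrite -[X in measurable X]setTI.
suff m : measurable_fun [set: k.-tuple R]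
  (fun t : k.-tuple R => count (fun y => (y < a)%R) t <= i)%N by exact: m.
apply: measurable_fun_leq; last exact: measurable_cst.
apply: measurable_count; apply: measurable_fun_ltr => //; exact: measurable_cst.
Qed.

Lemma measurable_sort_desc k i :
  measurable_fun [set: k.-tuple R] (fun t : k.-tuple R => (sort_desc t)`_i).
Proof.
have [ik|ki] := ltnP i k; last first.
  apply: eq_measurable_fun (measurable_cst (0 : R)) => t _.
  by rewrite nth_default// size_sort_desc size_tuple.
apply: eq_measurable_fun (measurable_sort_asc (k - i.+1)) => t _.
by rewrite sort_descE nth_rev size_sort_asc size_tuple.
Qed.

(** * Measurability of the gains from trade *)

Section gft.
Variables (M N : nat).
Let T := (M.-tuple R * N.-tuple R)%type.

Let mdesc i : measurable_fun [set: T] (fun p : T => (sort_desc p.1)`_i).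
Proof. exact: (measurableT_comp (measurable_sort_desc i) measurable_fst). Qed.

Let masc i : measurable_fun [set: T] (fun p : T => (sort_asc p.2)`_i).
Proof. exact: (measurableT_comp (measurable_sort_asc i) measurable_snd). Qed.

Lemma measurable_rstar : measurable_fun [set: T] (fun p : T => rstar p.1 p.2).
Proof.
apply: (@eq_measurable_fun _ _ _ _ _ (fun p : T =>
    \big[maxn/0%N]_(i <- index_enum 'I_(minn M N))
      (if (sort_asc p.2)`_i <= (sort_desc p.1)`_i then i.+1 else 0%N))) => [p _|].
  by rewrite /rstar !size_tuple [RHS]big_mkcond.
elim: (index_enum _) => [|i r IH].
  by under eq_fun do rewrite big_nil; exact: measurable_cst.
under eq_fun do rewrite big_cons; apply: measurable_fun_maxn => //.
by apply: measurable_fun_ifT; [exact: measurable_fun_ler|exact: measurable_cst..].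
Qed.

Lemma measurable_gft_k k : measurable_fun [set: T] (fun p : T => gft_k p.1 p.2 k).
Proof. by apply: measurable_sum => i; apply: measurable_funB. Qed.

Lemma measurable_gft_opt : measurable_fun [set: T] (fun p : T => gft_opt p.1 p.2).
Proof. exact: measurable_nat_dep measurable_rstar measurable_gft_k. Qed.

Lemma measurable_gft_str : measurable_fun [set: T] (fun p : T => gft_str p.1 p.2).
Proof.
apply: (measurable_nat_dep (F := fun k (p : T) => gft_k p.1 p.2 k));
  last exact: measurable_gft_k.
(* Once the value of [rstar] is fixed, the number of trades depends on a single comparison. *)
apply: (measurable_nat_dep (k := fun p : T => rstar p.1 p.2) (F := fun r (p : T) =>
  if r is r'.+1 then
    (if ((r < size p.2)%N) && ((sort_asc p.2)`_r <= (sort_desc p.1)`_r') then r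
     else r')
  else 0%N)); first exact: measurable_rstar.
case=> [|r]; first exact: measurable_cst.
apply: measurable_fun_ifT; [|exact: measurable_cst..].
under eq_fun do rewrite size_tuple.
by apply: measurable_and; [exact: measurable_cst|exact: measurable_fun_ler].
Qed.

End gft.
End Measurability.

(** * Independent samples *)

Section IteratedExpectation.
Local Open Scope classical_set_scope.
Local Open Scope ereal_scope.
Variable R : realType.
Implicit Types (P Q : probability R R) (f g : seq R -> \bar R).

Lemma eq_iter_expect P k f g : (forall l, size l = k -> f l = g l) ->
  iter_expect P k f = iter_expect P k g.
Proof.
elim: k f g => [|k IH] f g fg /=; first exact: fg.
by apply: eq_integral => x _; apply: IH => l lk; apply: fg; rewrite /= lk.
Qed.

Lemma iter_expect_ge0 P k f : (forall l, 0 <= f l) -> 0 <= iter_expect P k f.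
Proof.
elim: k f => [|k IH] f f0 //=.
by apply: integral_ge0 => x _; exact: IH.
Qed.

Lemma iter_expect_cst P k c : iter_expect P k (fun=> c) = c.
Proof.
elim: k => //= k IH; rewrite (eq_integral (cst c)) ?integral_cst//=.
by rewrite probability_setT mule1.
Qed.

(** The unread coordinates are innermost, where a constant is integrated against a probability. *)
Lemma iter_expect_take P m c f :
  iter_expect P (m + c) (fun l => f (take m l)) = iter_expect P m f.
Proof.
elim: m f => [|m IH] f.
  by under eq_iter_expect do rewrite take0; rewrite iter_expect_cst.
by rewrite addSn /=; apply: eq_integral => x _; rewrite (IH (fun l => f (x :: l))).
Qed.

Lemma iter_expect_rcons P k f :
  iter_expect P k.+1 f = iter_expect P k (fun l => \int[P]_x f (rcons l x)).
Proof.
elim: k f => [//|k IH] f.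
rewrite [LHS]/= [RHS]/=; apply: eq_integral => x _.
exact: (IH (fun l => f (x :: l))).
Qed.

Definition tcons k (p : R * k.-tuple R) : k.+1.-tuple R := [tuple of p.1 :: p.2].

Lemma measurable_tcons k : measurable_fun [set: R * k.-tuple R] (@tcons k).
Proof. exact: measurable_cons. Qed.

HB.instance Definition _ k :=
  isMeasurableFun.Build _ _ _ _ (@tcons k) (@measurable_tcons k).

(** The product law, built in the order of [iter_expect] so that Tonelli's theorem identifies the
    two. *)
Fixpoint iid P k : probability (k.-tuple R) R :=
  if k is k'.+1 then distribution (P \x iid P k') (@tcons k')
  else dirac ([tuple] : 0.-tuple R).

Lemma measurable_tuple_cons k f x :
  measurable_fun [set: k.+1.-tuple R] (fun t : k.+1.-tuple R => f t) ->
  measurable_fun [set: k.-tuple R] (fun t : k.-tuple R => f (x :: t)).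
Proof.
move=> mf; have := measurableT_comp mf (@measurable_tcons k).
by move=> /measurable_fun_pair2; apply.
Qed.

Lemma integral_iid P k f : (forall l, 0 <= f l) ->
  measurable_fun [set: k.-tuple R] (fun t : k.-tuple R => f t) ->
  \int[iid P k]_t f t = iter_expect P k f.
Proof.
elim: k f => [|k IH] f f0 mf.
  by rewrite /= integral_dirac// diracT mul1e.
rewrite [iid _ _]/= ge0_integral_distribution//.
rewrite fubini_tonelli1; first last.
- by move=> p; exact: f0.
- exact: (measurableT_comp mf (@measurable_tcons k)).
apply: eq_integral => x _; rewrite /fubini_F /=.
by apply: (IH (fun l => f (x :: l))) => //; exact: measurable_tuple_cons.
Qed.

Lemma measurable_tuple_rot k a f : (a < k)%N ->
  measurable_fun [set: k.-tuple R] (fun t : k.-tuple R => f t) ->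
  measurable_fun [set: k.-tuple R] (fun t : k.-tuple R => f (rot a t)).
Proof.
move=> ak mf; have := measurableT_comp mf (measurable_rot ak).
by apply: eq_measurable_fun => t _ /=; rewrite val_nth_tuple// size_rot size_tuple.
Qed.

(** The rotation moves the outermost variable to the innermost place. Tonelli's theorem, for the
    first coordinate against the remaining ones, undoes this. *)
Lemma iter_expect_rot1 P k f : (forall l, 0 <= f l) ->
  measurable_fun [set: k.+1.-tuple R] (fun t : k.+1.-tuple R => f t) ->
  iter_expect P k.+1 (fun l => f (rot 1 l)) = iter_expect P k.+1 f.
Proof.
move=> f0 mf; rewrite [RHS]iter_expect_rcons [LHS]/=.
case: k mf => [//|k] mf.
have mrot := measurable_tuple_rot (isT : 1 < k.+2)%N mf.
have mp : measurable_fun [set: R * k.+1.-tuple R]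
    (fun p : R * k.+1.-tuple R => f (rot 1 (p.1 :: p.2))).
  exact: (measurableT_comp mrot (@measurable_tcons _)).
transitivity (\int[P]_x \int[iid P k.+1]_t f (rot 1 (x :: t))).
  apply: eq_integral => x _.
  rewrite (@integral_iid P _ (fun l => f (rot 1 (x :: l))))//.
  exact: (@measurable_tuple_cons _ (fun l => f (rot 1 l))).
transitivity (\int[iid P k.+1]_t \int[P]_x f (rot 1 (x :: t))).
  exact: (fubini_tonelli (m1 := P) (m2 := iid P k.+1) _ mp).
rewrite (@integral_iid P _ (fun l => \int[P]_x f (rot 1 (x :: l))))//.
- by apply: eq_iter_expect => l _; under eq_integral do rewrite rot1_cons.
- by move=> l; apply: integral_ge0.
- exact: (measurable_fun_fubini_tonelli_G (m1 := P) _ mp).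
Qed.

Lemma iter_expect_rot P k a f : (a < k)%N -> (forall l, 0 <= f l) ->
  measurable_fun [set: k.-tuple R] (fun t : k.-tuple R => f t) ->
  iter_expect P k (fun l => f (rot a l)) = iter_expect P k f.
Proof.
case: k => // k + f0; elim: a f f0 => [|a IH] f f0 ak mf.
  by under eq_iter_expect do rewrite rot0.
transitivity (iter_expect P k.+1 (fun l => f (rot 1 (rot a l)))).
  by apply: eq_iter_expect => l lk; rewrite -rotS// lk ltnW.
have k1 : (1 < k.+1)%N by exact: leq_trans ak.
rewrite (IH (fun l => f (rot 1 l)))//; [|exact: ltnW|exact: measurable_tuple_rot].
exact: iter_expect_rot1.
Qed.

(** Independence; the constant [c] collects the factors already read during the induction. *)
Lemma iter_expect_prod P k (h : nat -> R -> \bar R) c : 0 <= c ->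
  (forall i x, 0 <= h i x) -> (forall i, measurable_fun [set: R] (h i)) ->
  iter_expect P k (fun l => c * \prod_(i < k) h i (l`_i)%R) =
  c * \prod_(i < k) \int[P]_x h i x.
Proof.
elim: k h c => [|k IH] h c c0 h0 mh; first by rewrite /= !big_ord0.
transitivity (\int[P]_x (c * h 0%N x * \prod_(i < k) \int[P]_y h i.+1 y)).
  apply: eq_integral => x _; rewrite -(IH (fun i => h i.+1) (c * h 0%N x))//.
    by apply: eq_iter_expect => l _; rewrite big_ord_recl /= muleA.
  exact: mule_ge0.
under eq_integral do rewrite -muleA.
rewrite ge0_integralZl//; last first.
- by move=> x _; rewrite mule_ge0// prode_ge0// => i _; exact: integral_ge0.
- by apply: emeasurable_funM => //; exact: measurable_cst.
rewrite ge0_integralZr//; first by rewrite big_ord_recl.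
by rewrite prode_ge0// => i _; exact: integral_ge0.
Qed.

(** * Expectations over both samples *)

Section Auction.
Variables FB FS : probability R R.
Implicit Types F : seq R -> seq R -> R.

Definition measurable_profile M N F :=
  measurable_fun [set: M.-tuple R * N.-tuple R]
    (fun p : M.-tuple R * N.-tuple R => F p.1 p.2).

Lemma measurable_profileE M N F : measurable_profile M N F ->
  measurable_fun [set: M.-tuple R * N.-tuple R]
    (fun p : M.-tuple R * N.-tuple R => (F p.1 p.2)%:E).
Proof. by move=> mF; apply/measurable_EFinP. Qed.

Lemma measurable_profile2 M N F (b : M.-tuple R) : measurable_profile M N F ->
  measurable_fun [set: N.-tuple R] (fun t : N.-tuple R => (F b t)%:E).
Proof. by move=> /measurable_profileE /measurable_fun_pair2; apply. Qed.

Lemma measurable_profile_inner M N F : (forall b s, (0 <= F b s)%R) ->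
  measurable_profile M N F ->
  measurable_fun [set: M.-tuple R]
    (fun t : M.-tuple R => iter_expect FS N (fun s => (F t s)%:E)).
Proof.
move=> F0 mF.
have := measurable_fun_fubini_tonelli_F (m2 := iid FS N) _ (measurable_profileE mF).
move=> /(_ (fun p => F0 _ _)); apply: eq_measurable_fun => t _.
rewrite /fubini_F (@integral_iid _ _ (fun s => (F t s)%:E))//.
- by move=> s; rewrite lee_fin.
- exact: measurable_profile2.
Qed.

Lemma expect_auctionE M N F : (forall b s, (0 <= F b s)%R) ->
  measurable_profile M N F ->
  expect_auction FB FS M N F = \int[iid FB M \x iid FS N]_p (F p.1 p.2)%:E.
Proof.
move=> F0 mF; rewrite fubini_tonelli1; first last.
- by move=> p; rewrite lee_fin.
- exact: measurable_profileE.
rewrite /expect_auction -integral_iid; first last.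
- exact: measurable_profile_inner.
- by move=> b; apply: iter_expect_ge0 => s; rewrite lee_fin.
apply: eq_integral => b _; rewrite /fubini_F /=.
rewrite (@integral_iid _ _ (fun s => (F b s)%:E))//.
- by move=> s; rewrite lee_fin.
- exact: measurable_profile2.
Qed.

Lemma eq_expect_auction M N F G :
  (forall b s, size b = M -> size s = N -> F b s = G b s) ->
  expect_auction FB FS M N F = expect_auction FB FS M N G.
Proof.
move=> FG; apply: eq_iter_expect => b bM; apply: eq_iter_expect => s sN.
by rewrite FG.
Qed.

Lemma expect_auction_rot M N a d F : (a < M)%N -> (d < N)%N ->
  (forall b s, (0 <= F b s)%R) -> measurable_profile M N F ->
  expect_auction FB FS M N (fun b s => F (rot a b) (rot d s)) =
  expect_auction FB FS M N F.
Proof.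
move=> aM dN F0 mF; rewrite /expect_auction.
transitivity (iter_expect FB M (fun b => iter_expect FS N (fun s => (F (rot a b) s)%:E))).
  apply: eq_iter_expect => b bM.
  apply: (@iter_expect_rot _ _ d (fun s => (F (rot a b) s)%:E)) => //.
    by move=> s; rewrite lee_fin.
  have bs : size (rot a b) == M by rewrite size_rot bM.
  exact: (measurable_profile2 (Tuple bs) mF).
apply: (@iter_expect_rot _ _ a (fun b => iter_expect FS N (fun s => (F b s)%:E))) => //.
  by move=> b; apply: iter_expect_ge0 => s; rewrite lee_fin.
exact: measurable_profile_inner.
Qed.

Lemma expect_auction_take m n c c' F :
  expect_auction FB FS (m + c) (n + c') (fun b s => F (take m b) (take n s)) =
  expect_auction FB FS m n F.
Proof.
rewrite -[RHS](iter_expect_take FB m c); apply: eq_iter_expect => b _.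
exact: (iter_expect_take _ _ _ (fun s => (F (take m b) s)%:E)).
Qed.

Lemma measurable_profile_map M N M' N' F (u v : seq R -> seq R) :
  (forall b, size b = M -> size (u b) = M') ->
  (forall s, size s = N -> size (v s) = N') ->
  measurable_fun [set: M.-tuple R]
    (fun t : M.-tuple R => [tuple ((u t)`_i)%R | i < M']) ->
  measurable_fun [set: N.-tuple R]
    (fun t : N.-tuple R => [tuple ((v t)`_i)%R | i < N']) ->
  measurable_profile M' N' F ->
  measurable_profile M N (fun b s => F (u b) (v s)).
Proof.
move=> su sv mu mv mF.
have muv := measurable_fun_pair (measurableT_comp mu (@measurable_fst _ _ _ _))
  (measurableT_comp mv (@measurable_snd _ _ _ _)).
apply: eq_measurable_fun (measurableT_comp mF muv) => p _ /=.
by rewrite !val_nth_tuple// ?su ?sv ?size_tuple.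
Qed.

Lemma expect_auction_le M N F G : (forall b s, (0 <= F b s)%R) ->
  (forall b s, (0 <= G b s)%R) ->
  measurable_profile M N F -> measurable_profile M N G ->
  (forall b s, size b = M -> size s = N -> (F b s <= G b s)%R) ->
  expect_auction FB FS M N F <= expect_auction FB FS M N G.
Proof.
move=> F0 G0 mF mG FG; rewrite !expect_auctionE//; apply: ge0_le_integral => //.
- by move=> p _; rewrite lee_fin.
- exact: measurable_profileE.
- exact: measurable_profileE.
- by move=> p _; rewrite lee_fin FG// size_tuple.
Qed.

Lemma expect_auctionD M N F G : (forall b s, (0 <= F b s)%R) ->
  (forall b s, (0 <= G b s)%R) ->
  measurable_profile M N F -> measurable_profile M N G ->
  expect_auction FB FS M N (fun b s => F b s + G b s)%R =
  expect_auction FB FS M N F + expect_auction FB FS M N G.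
Proof.
move=> F0 G0 mF mG; rewrite !expect_auctionE//.
- rewrite -ge0_integralD//; first by move=> p _; rewrite lee_fin.
  + exact: measurable_profileE.
  + by move=> p _; rewrite lee_fin.
  + exact: measurable_profileE.
- by move=> b s; rewrite addr_ge0.
- exact: measurable_funD.
Qed.

Lemma expect_auctionZ M N F c : (0 <= c)%R -> (forall b s, (0 <= F b s)%R) ->
  measurable_profile M N F ->
  expect_auction FB FS M N (fun b s => c * F b s)%R =
  c%:E * expect_auction FB FS M N F.
Proof.
move=> c0 F0 mF; rewrite !expect_auctionE//.
- rewrite -ge0_integralZl//; first exact: measurable_profileE.
  by move=> p _; rewrite lee_fin.
- by move=> b s; rewrite mulr_ge0.
- by apply: measurable_funM => //; exact: measurable_cst.
Qed.

Lemma expect_auction_sum M N (I : Type) (r : seq I) (F : I -> seq R -> seq R -> R) :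
  (forall i b s, (0 <= F i b s)%R) -> (forall i, measurable_profile M N (F i)) ->
  expect_auction FB FS M N (fun b s => \sum_(i <- r) F i b s)%R =
  \sum_(i <- r) expect_auction FB FS M N (F i).
Proof.
move=> F0 mF.
under eq_bigr do rewrite expect_auctionE//.
rewrite expect_auctionE; first last.
- exact: measurable_sum.
- by move=> b s; rewrite sumr_ge0.
rewrite -ge0_integral_sum//.
- by apply: eq_integral => p _; rewrite sumEFin.
- by move=> i; exact: measurable_profileE.
- by move=> i p _; rewrite lee_fin.
Qed.

(** Pair [i] uses only its own buyer and seller, so distinct pairs are independent. The surplus
    buyers are unread and integrate out. *)
Lemma expect_auction_prod M N (h : nat -> R -> R -> R) : (N <= M)%N ->
  (forall i x y, (0 <= h i x y)%R) ->
  (forall i, measurable_fun [set: R * R] (fun p : R * R => h i p.1 p.2)) ->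
  expect_auction FB FS M N (fun b s => \prod_(i < N) h i b`_i s`_i)%R =
  \prod_(i < N) \int[FB]_x \int[FS]_y (h i x y)%:E.
Proof.
move=> NM h0 mh; rewrite -(subnKC NM) /expect_auction.
pose H i x := \int[FS]_y (h i x y)%:E.
have mhE i : measurable_fun [set: R * R] (fun p : R * R => (h i p.1 p.2)%:E).
  exact/measurable_EFinP.
have H0 i x : 0 <= H i x by apply: integral_ge0 => y _; rewrite lee_fin.
transitivity (iter_expect FB (N + (M - N)) (fun b => 1 * \prod_(i < N) H i ((take N b)`_i)%R)).
  apply: eq_iter_expect => b _.
  transitivity (iter_expect FS N (fun s => 1 * \prod_(i < N) (h i b`_i s`_i)%R%:E)).
    by apply: eq_iter_expect => s _; rewrite mul1e prodEFin.
  rewrite (@iter_expect_prod FS N (fun i y => (h i b`_i y)%R%:E))//.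
  - by congr (_ * _); apply: eq_bigr => i _; rewrite nth_take.
  - by move=> i y; rewrite lee_fin.
  - by move=> i; have /measurable_fun_pair2 := mhE i; apply.
rewrite (@iter_expect_take _ _ _ (fun b => 1 * \prod_(i < N) H i (b`_i)%R)).
rewrite (@iter_expect_prod FB N H)//; first by rewrite mul1e.
move=> i; apply: (measurable_fun_fubini_tonelli_F (m2 := FS) _ (mhE i)).
by move=> p; rewrite lee_fin.
Qed.

End Auction.
End IteratedExpectation.

(** * Comparison of expected gains *)

Section Comparison.
Local Open Scope classical_set_scope.
Local Open Scope ereal_scope.
Variable R : realType.
Variables FB FS : probability R R.

Let gain (x y : R) : R := Num.max 0%R (x - y)%R.

Let gain_ge0 x y : (0 <= gain x y)%R.
Proof. by rewrite le_max lexx. Qed.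

Let measurable_gain : measurable_fun [set: R * R] (fun p : R * R => gain p.1 p.2).
Proof.
apply: measurable_maxr; first exact: measurable_cst.
by apply: measurable_funB.
Qed.

Lemma pair_weight_ge0 (u v x y : R) : (0 <= u)%R -> (0 <= v)%R ->
  (0 <= pair_weight u v x y)%R.
Proof. by rewrite /pair_weight; case: ifP. Qed.

Lemma measurable_pair_weight (u v : R) :
  measurable_fun [set: R * R] (fun p : R * R => pair_weight u v p.1 p.2).
Proof.
apply: measurable_fun_ifT; [exact: measurable_fun_ler|exact: measurable_cst..].
Qed.

Lemma integral_pairE (h : R -> R -> R) : (forall x y, (0 <= h x y)%R) ->
  measurable_fun [set: R * R] (fun p : R * R => h p.1 p.2) ->
  \int[FB]_x \int[FS]_y (h x y)%:E = \int[FB \x FS]_p (h p.1 p.2)%:E.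
Proof.
move=> h0 mh; rewrite fubini_tonelli1//; first exact/measurable_EFinP.
by move=> p; rewrite lee_fin.
Qed.

Lemma integral_trade :
  \int[FB]_x \int[FS]_y (pair_weight 1%R 0%R x y)%:E = prob_b_ge_s FB FS.
Proof.
rewrite integral_pairE; first last.
- exact: measurable_pair_weight.
- by move=> x y; exact: pair_weight_ge0.
rewrite /prob_b_ge_s -[X in _ = _ X](setIT _) -integral_indic//.
- apply: eq_integral => p _; rewrite indicE /pair_weight.
  by case: ifPn => h; [rewrite mem_set|rewrite memNset//; exact/negP].
- rewrite -[X in measurable X]setTI.
  have m : measurable_fun [set: R * R] (fun p : R * R => (p.2 <= p.1)%R).
    exact: measurable_fun_ler.
  exact: (m measurableT [set true]).
Qed.

Lemma integral_half_trade (r : R) : prob_b_ge_s FB FS = r%:E ->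
  \int[FB]_x \int[FS]_y (pair_weight 2^-1%R 1%R x y)%:E = (1 - r / 2)%:E.
Proof.
move=> rE; have m1 := measurable_pair_weight 1%R 0%R.
have m2 := measurable_pair_weight 2^-1%R 1%R.
have p1 x y : (0 <= pair_weight 1 0 x y :> R)%R by exact: pair_weight_ge0.
have p2 x y : (0 <= pair_weight 2^-1 1 x y :> R)%R.
  by apply: pair_weight_ge0 => //; rewrite invr_ge0.
have h0 : (0 <= 2^-1 :> R)%R by rewrite invr_ge0.
(* The two weighted terms add up to 1 pointwise. Stating this as a sum avoids subtracting extended
   reals and excludes infinite values. *)
have : \int[FB \x FS]_p (pair_weight 2^-1 1 p.1 p.2)%:E +
   2^-1%:E * \int[FB \x FS]_p (pair_weight 1 0 p.1 p.2)%:E = 1.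
  rewrite -ge0_integralZl//; first last.
  - by move=> p _; rewrite lee_fin.
  - exact/measurable_EFinP.
  rewrite -ge0_integralD//; first last.
  - apply/measurable_EFinP; apply: measurable_funM => //; exact: measurable_cst.
  - by move=> p _; rewrite lee_fin mulr_ge0.
  - exact/measurable_EFinP.
  - by move=> p _; rewrite lee_fin.
  rewrite (eq_integral (cst 1)); last first.
    move=> p _ /=; rewrite -EFinM -EFinD; congr (_%:E).
    by rewrite /pair_weight; case: ifP => _; lra.
  rewrite integral_cst// mul1e; exact: probability_setT.
rewrite -!integral_pairE// integral_trade rE.
move: (\int[FB]_x _) => [z| |] //=.
rewrite -EFinM -EFinD => -[h]; congr (_%:E); lra.
Qed.

Lemma measurable_profile_nth M N (h : R -> R -> R) i j :
  measurable_fun [set: R * R] (fun p : R * R => h p.1 p.2) ->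
  measurable_profile M N (fun b s => h (b`_i)%R (s`_j)%R).
Proof.
move=> mh; have := measurable_fun_pair
  (measurableT_comp (measurable_nth i) (@measurable_fst _ _ (M.-tuple R) (N.-tuple R)))
  (measurableT_comp (measurable_nth j) (@measurable_snd _ _ (M.-tuple R) (N.-tuple R))).
exact: measurableT_comp mh.
Qed.

(* Only pairs of index at least 1 are weighted, so the weights are independent of
   the gain of pair 0. *)
Definition weighted_gain N (u v : R) (b s : seq R) : R :=
  (Num.max 0 (b`_0 - s`_0) *
   \prod_(i < N.-1) pair_weight u v b`_i.+1 s`_i.+1)%R.

Lemma weighted_gain_ge0 N u v b s : (0 <= u)%R -> (0 <= v)%R ->
  (0 <= weighted_gain N u v b s)%R.
Proof.
move=> u0 v0; apply: mulr_ge0; first exact: gain_ge0.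
by apply: prodr_ge0 => i _; exact: pair_weight_ge0.
Qed.

Lemma measurable_weighted_gain M N u v :
  measurable_profile M N (weighted_gain N u v).
Proof.
apply: measurable_funM; first exact: measurable_profile_nth measurable_gain.
apply: measurable_prod => i _.
exact: measurable_profile_nth (measurable_pair_weight u v).
Qed.

Lemma expect_weighted_gain M N (u v w : R) : (0 < N)%N -> (N <= M)%N ->
  (0 <= u)%R -> (0 <= v)%R ->
  \int[FB]_x \int[FS]_y (pair_weight u v x y)%:E = w%:E ->
  expect_auction FB FS M N (weighted_gain N u v) =
  (w ^+ N.-1)%:E * \int[FB]_x \int[FS]_y (Num.max 0 (x - y))%:E.
Proof.
move=> N0 NM u0 v0 wE.
(* Pair 0 carries its gain and every other pair its weight, giving a product over independent
   pairs. *)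
pose h i := if i is 0%N then gain else pair_weight u v.
transitivity (expect_auction FB FS M N (fun b s => \prod_(i < N) h i b`_i s`_i)%R).
  apply: eq_expect_auction => b s _ _; case: N N0 {NM} => // N _.
  by rewrite big_ord_recl.
rewrite expect_auction_prod//; first last.
- case=> [|i]; [exact: measurable_gain|exact: measurable_pair_weight].
- by case=> [|i] x y; [exact: gain_ge0|exact: pair_weight_ge0].
case: N N0 {NM} => // N _; rewrite big_ord_recl muleC; congr (_ * _).
under eq_bigr do rewrite /= wE.
by rewrite prodEFin prodr_const card_ord.
Qed.

Lemma measurable_rot_profile M N (F : seq R -> seq R -> R) a d : (a < M)%N ->
  (d < N)%N -> measurable_profile M N F ->
  measurable_profile M N (fun b s => F (rot a b) (rot d s)).
Proof.
move=> aM dN; apply: measurable_profile_map; try by move=> ?; rewrite size_rot.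
- exact: measurable_rot.
- exact: measurable_rot.
Qed.

(** By exchangeability all rotations have the same expectation. *)
Lemma expect_auction_sum_rot M N (F : seq R -> seq R -> R) :
  (forall b s, (0 <= F b s)%R) -> measurable_profile M N F ->
  expect_auction FB FS M N (fun b s =>
    \sum_(a < M) \sum_(d < N) F (rot a b) (rot d s))%R =
  (M%:R * N%:R)%:E * expect_auction FB FS M N F.
Proof.
move=> F0 mF.
rewrite (@expect_auction_sum _ _ _ M N _ _
  (fun (a : 'I_M) b s => \sum_(d < N) F (rot a b) (rot d s))%R); first last.
- by move=> a; apply: measurable_sum => d; exact: measurable_rot_profile.
- by move=> a b s; apply: sumr_ge0.
transitivity (\sum_(a < M) (N%:R)%:E * expect_auction FB FS M N F).
  apply: eq_bigr => a _.
  rewrite (@expect_auction_sum _ _ _ M N _ _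
    (fun (d : 'I_N) b s => F (rot a b) (rot d s)))//; last first.
    by move=> d; exact: measurable_rot_profile.
  rewrite (eq_bigr (fun=> expect_auction FB FS M N F)); last first.
    by move=> d _; exact: expect_auction_rot.
  by rewrite sumr_const card_ord mule_natl.
by rewrite sumr_const card_ord EFinM -muleA [RHS]mule_natl.
Qed.

Lemma measurable_take_opt m n c : measurable_profile (m + c) (n + c)
  (fun b s : seq R => gft_opt (take m b) (take n s)).
Proof.
apply: measurable_profile_map (@measurable_gft_opt R m n).
- by move=> b bm; rewrite size_takel// bm leq_addr.
- by move=> b bm; rewrite size_takel// bm leq_addr.
- exact: measurable_take.
- exact: measurable_take.
Qed.

(** Integrates [gft_windows_le_str], each window having the law of the original market. In the loss
    term one factor [M N] is the coefficient there and the other counts rotations. Nothing is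
    subtracted, so infinite expectations are allowed. *)
Lemma OPT_windows_le_STR m n c t (r : R) (e := \int[FB]_x \int[FS]_y (Num.max 0 (x - y))%:E)
    (M := (m + c)%N) (N := (n + c)%N) :
  (0 < n)%N -> (n <= m)%N -> (2 * N <= c * t)%N ->
  (r <= 1)%R -> prob_b_ge_s FB FS = r%:E ->
  (M%:R * N%:R)%:E * OPT FB FS m n + (N%:R * c%:R / 2)%:E * e <=
  (M%:R * N%:R)%:E * STR FB FS M N +
  (M%:R * N%:R * (M%:R * N%:R * 4 ^+ t) * (1 - r / 2) ^+ N.-1)%:E * e.
Proof.
move=> n0 nm Nct r1 rE.
have N0 : (0 < N)%N by rewrite /N; lia.
have NM : (N <= M)%N by rewrite /N /M; lia.
have c0 : (0 <= N%:R * c%:R / 2 :> R)%R by rewrite divr_ge0// mulr_ge0.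
have MN0 : (0 <= M%:R * N%:R :> R)%R by rewrite mulr_ge0.
have h0 : (0 <= 2^-1 :> R)%R by rewrite invr_ge0.
have k0 : (0 <= M%:R * N%:R * 4 ^+ t :> R)%R by rewrite mulr_ge0// exprn_ge0.
pose win (b s : seq R) : R := (\sum_(a < M) \sum_(d < N)
  gft_opt (take m (rot a b)) (take n (rot d s)))%R.
pose bad b s : R := (M%:R * N%:R * 4 ^+ t * weighted_gain N 2^-1 1 b s)%R.
have mwin : measurable_profile M N win.
  apply: measurable_sum => a; apply: measurable_sum => d.
  have := measurable_rot_profile (ltn_ord a) (ltn_ord d) (@measurable_take_opt m n c).
  exact.
have win0 b s : (0 <= win b s)%R.
  by apply: sumr_ge0 => a _; apply: sumr_ge0 => d _; exact: gft_opt_ge0.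
have bad0 b s : (0 <= bad b s)%R by rewrite mulr_ge0// weighted_gain_ge0.
have mbad : measurable_profile M N bad.
  by apply: measurable_funM; [exact: measurable_cst|exact: measurable_weighted_gain].
have mone : measurable_profile M N (weighted_gain N 1 1) by exact: measurable_weighted_gain.
have one0 b s : (0 <= weighted_gain N 1 1 b s)%R by exact: weighted_gain_ge0.
have mbads : measurable_profile M N
    (fun b s => \sum_(a < M) \sum_(d < N) bad (rot a b) (rot d s))%R.
  apply: measurable_sum => a; apply: measurable_sum => d.
  exact: measurable_rot_profile.
have mstr : measurable_profile M N (@gft_str R) by exact: measurable_gft_str.
have str0 b s : (0 <= gft_str b s :> R)%R by exact: gft_str_ge0.
have Ewin : expect_auction FB FS M N win = (M%:R * N%:R)%:E * OPT FB FS m n.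
  rewrite /win (@expect_auction_sum_rot M N (fun b s : seq R => gft_opt (take m b) (take n s))).
  - by congr (_ * _); exact: expect_auction_take.
  - by move=> b s; exact: gft_opt_ge0.
  - exact: measurable_take_opt.
have Eone : expect_auction FB FS M N (weighted_gain N 1 1) = e.
  rewrite (@expect_weighted_gain _ _ _ _ 1%R)//; first by rewrite expr1n mul1e.
  rewrite integral_pairE; [|by move=> ? ?; exact: pair_weight_ge0|exact: measurable_pair_weight].
  rewrite (eq_integral (cst 1)).
    by rewrite integral_cst// mul1e; exact: probability_setT.
  by move=> p _; rewrite /pair_weight; case: ifP.
have Ebad : expect_auction FB FS M N bad =
    (M%:R * N%:R * 4 ^+ t * (1 - r / 2) ^+ N.-1)%:E * e.
  rewrite expect_auctionZ//; last 2 first.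
  - by move=> b s; exact: weighted_gain_ge0.
  - exact: measurable_weighted_gain.
  rewrite (@expect_weighted_gain _ _ _ _ (1 - r / 2)%R)//; last exact: integral_half_trade.
  by rewrite muleA -EFinM.
rewrite -Ewin -{1}Eone.
have -> : (M%:R * N%:R * (M%:R * N%:R * 4 ^+ t) * (1 - r / 2) ^+ N.-1)%:E * e =
    expect_auction FB FS M N
      (fun b s => \sum_(a < M) \sum_(d < N) bad (rot a b) (rot d s))%R.
  rewrite expect_auction_sum_rot// Ebad muleA -EFinM; congr (_%:E * _).
  by rewrite !mulrA.
rewrite /STR -!expect_auctionZ// -!expect_auctionD//; first last.
- by apply: measurable_funM => //; exact: measurable_cst.
- by move=> b s; rewrite mulr_ge0.
- by apply: measurable_funM => //; exact: measurable_cst.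
- by move=> b s; apply: sumr_ge0 => a _; apply: sumr_ge0.
- by move=> b s; rewrite mulr_ge0.
apply: expect_auction_le.
- by move=> b s; rewrite addr_ge0// mulr_ge0.
- move=> b s; rewrite addr_ge0 ?mulr_ge0//.
  by apply: sumr_ge0 => a _; apply: sumr_ge0.
- apply: measurable_funD => //.
  by apply: measurable_funM => //; exact: measurable_cst.
- apply: measurable_funD => //.
  by apply: measurable_funM => //; exact: measurable_cst.
move=> b s bM sN.
have -> : (weighted_gain N 1 1 b s = Num.max 0 (b`_0 - s`_0))%R.
  rewrite /weighted_gain big1 ?mulr1// => i _.
  by rewrite /pair_weight; case: ifP.
apply: le_trans (gft_windows_le_str n0 nm Nct bM sN) _.
rewrite lerD2l mulr_sumr; apply: ler_sum => a _.
rewrite mulr_sumr; apply: ler_sum => d _.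
rewrite /bad -!mulrA !ler_wpM2l//.
(* Since [rstar] is invariant under rotation, its bound can be read off the rotated samples, whose
   weights omit exactly the pair whose gain is counted. *)
rewrite (@rstar_perm _ b (rot a b) s (rot d s)); try by rewrite perm_sym perm_rot.
rewrite /weighted_gain [leRHS]mulrCA [leLHS]mulrC ler_wpM2l ?gain_ge0//.
have := @rstar_lt_le_prod _ (rot a b) (rot d s) t.
by rewrite !size_rot sN bM; apply.
Qed.

(* Needed separately: the comparison of expectations is void when E(b - s)^+ is
   infinite. *)
Lemma STR_infinite M N (r : R) : (3 < N)%N -> (N <= M)%N -> (0 < r)%R ->
  prob_b_ge_s FB FS = r%:E ->
  \int[FB]_x \int[FS]_y (Num.max 0 (x - y))%:E = +oo ->
  STR FB FS M N = +oo.
Proof.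
move=> N3 NM r0 rE eoo; apply/eqP; rewrite -leye_eq.
have N0 : (0 < N)%N by exact: leq_trans N3.
have h0 : (0 < 2^-1 :> R)%R by rewrite invr_gt0.
have w0 b s : (0 <= weighted_gain N 1 0 b s)%R by exact: weighted_gain_ge0.
have mw : measurable_profile M N (weighted_gain N 1 0) by exact: measurable_weighted_gain.
apply: (@le_trans _ _ (2^-1%:E * expect_auction FB FS M N (weighted_gain N 1 0))).
  rewrite (@expect_weighted_gain _ _ _ _ r)//; last by rewrite integral_trade.
  by rewrite eoo gt0_muley ?lte_fin ?exprn_gt0// gt0_muley ?lte_fin.
rewrite -expect_auctionZ ?(ltW h0)//; apply: expect_auction_le.
- by move=> b s; rewrite mulr_ge0 ?(ltW h0).
- by move=> b s; exact: gft_str_ge0.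
- by apply: measurable_funM => //; exact: measurable_cst.
- exact: measurable_gft_str.
move=> b s bM sN; rewrite /weighted_gain -[X in X.-1]sN.
by apply: gft_str_ge_prod; rewrite sN// bM.
Qed.

(** If the expected gain [e] of a pair is finite, the last hypothesis times [N / 2] puts the loss
    coefficient below the margin, and both cancel. Otherwise [STR] is infinite. *)
Lemma OPT_le_STR m n c t (r : R) : (0 < n)%N -> (n <= m)%N -> (3 < n + c)%N ->
  (0 < c)%N -> (2 * (n + c) <= c * t)%N -> (0 < r <= 1)%R ->
  prob_b_ge_s FB FS = r%:E ->
  (2 * (m + c)%:R ^+ 2 * (n + c)%:R * (4 ^+ t * (1 - r / 2) ^+ (n + c).-1) <=
    c%:R)%R ->
  OPT FB FS m n <= STR FB FS (m + c) (n + c).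
Proof.
move=> n0 nm N3 c0 Nct /andP[r0 r1] rE small.
have := OPT_windows_le_STR n0 nm Nct r1 rE.
set e := \int[FB]_x _.
have e0 : 0 <= e.
  by apply: integral_ge0 => x _; apply: integral_ge0 => y _; rewrite lee_fin gain_ge0.
have [eoo|] := eqVneq e +oo.
  by rewrite (STR_infinite N3 _ r0 rE eoo) ?leey// leq_add2r.
rewrite -ltey => eoo.
have ef : e \is a fin_num by rewrite ge0_fin_numE.
set A : R := (_ * _ / 2)%R; set B : R := (_ * _ ^+ _)%R => le1.
have BA : (B <= A)%R.
  rewrite /B /A; have N0 : (0 <= (n + c)%:R / 2 :> R)%R by rewrite divr_ge0.
  by have := ler_wpM2l N0 small; lra.
have MN0 : (0 < (m + c)%:R * (n + c)%:R :> R)%R by rewrite mulr_gt0// ltr0n; lia.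
have : (((m + c)%:R * (n + c)%:R)%:E * OPT FB FS m n <=
        ((m + c)%:R * (n + c)%:R)%:E * STR FB FS (m + c) (n + c)).
  rewrite -(@leeD2rE _ (A%:E * e)) ?fin_numM//.
  apply: le_trans le1 _; rewrite leeD2l//.
  by rewrite lee_wpmul2r.
by rewrite lee_pmul2l// lte_fin.
Qed.

End Comparison.

(** * Size of the augmentation *)

Section Estimates.
Variable R : realType.

Lemma two_le_expR1 : 2 <= expR 1 :> R.
Proof. by have := expR_ge1Dx (1 : R); lra. Qed.

(** Multiplies [2 <= e], the cube of [x <= e^x], and the square of
    [y <= 32 e^(y/32) <= e^(5 + y/32)]. *)
Lemma poly_le_expR (x y : R) : 1 <= x -> 0 <= y ->
  2 * x ^+ 3 * y ^+ 2 <= expR (11 + 3 * x + y / 16).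
Proof.
move=> x1 y0.
have hx : x <= expR x by have := expR_ge1Dx x; lra.
have hy : y <= expR (5 + y / 32).
  have -> : 5 + y / 32 = 5%:R * 1 + y / 32 by ring.
  rewrite expRD expRM_natl.
  have h1 : y / 32 <= expR (y / 32) by have := expR_ge1Dx (y / 32); lra.
  have h2 : 32 <= expR 1 ^+ 5 :> R.
    rewrite (_ : 32 = 2 ^+ 5); last by rewrite -natrX.
    by rewrite lerXn2r// ?nnegrE ?expR_ge0// two_le_expR1.
  apply: le_trans (ler_pM _ _ h2 h1); lra.
have -> : 11 + 3 * x + y / 16 = 1 + 3%:R * x + 2%:R * (5 + y / 32) by field.
rewrite !expRD (expRM_natl 3) (expRM_natl 2).
have x0 : 0 <= x by lra.
rewrite ler_pM ?mulr_ge0 ?exprn_ge0//.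
  by rewrite ler_pM ?exprn_ge0 ?two_le_expR1// lerXn2r// nnegrE expR_ge0.
by rewrite lerXn2r// nnegrE expR_ge0.
Qed.

Lemma augmentation_suffices (m n c t : nat) (r : R) :
  (0 < n)%N -> (n <= m)%N -> 0 < r <= 1 ->
  128 * (1 + ln (m%:R / n%:R) + ln r^-1) / r <= c%:R ->
  t%:R <= 2 * (n + c)%:R / c%:R + 1 :> R ->
  2 * (m + c)%:R ^+ 2 * (n + c)%:R * (4 ^+ t * (1 - r / 2) ^+ (n + c).-1)
    <= c%:R.
Proof.
move=> n0 nm /andP[r0 r1].
set L := ln (m%:R / n%:R); set l := ln r^-1 => hc ht.
have n0' : 0 < n%:R :> R by rewrite ltr0n.
have mn1 : 1 <= m%:R / n%:R :> R by rewrite ler_pdivlMr// mul1r ler_nat.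
have L0 : 0 <= L by exact: ln_ge0.
have l0 : 0 <= l by apply: ln_ge0; rewrite invf_ge1.
have c0 : 0 < c%:R :> R.
  by apply: lt_le_trans hc; rewrite divr_gt0//; lra.
have cE : c%:R <> 0 :> R by apply/eqP; rewrite gt_eqF.
(* In the variables [x = N/c] and [y = r c] the factors become exponential: [M <= e^L N],
   [c = y e^l], [4^t <= e^(6x)] and [(1 - r/2)^(N-1) <= e^(-xy/4)]. *)
pose N : R := (n + c)%:R; pose x := N / c%:R; pose y := r * c%:R.
have NE : N = x * c%:R by rewrite /x divfK//; apply/eqP.
have x1 : 1 <= x by rewrite ler_pdivlMr// mul1r ler_nat leq_addl.
have y_ge : 128 * (1 + L + l) <= y by rewrite /y [r * _]mulrC -ler_pdivrMr.
have y0 : 0 <= y by apply: le_trans y_ge; lra.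
have hM : (m + c)%:R <= expR L * N.
  rewrite /L lnK ?posrE ?divr_gt0// ?ltr0n ?(leq_trans n0)// /N !natrD mulrDr divfK ?gt_eqF//.
  by rewrite lerD2l ler_peMl// ltW.
have hcl : c%:R = y * expR l.
  by rewrite /l lnK ?posrE ?invr_gt0// /y mulrAC mulfV ?mul1r ?gt_eqF.
(* Here [4 <= e^2] and [t <= 2x + 1 <= 3x]. *)
have h4 : 4 ^+ t <= expR (6 * x).
  apply: (@le_trans _ _ (expR 2 ^+ t)).
    rewrite lerXn2r ?nnegrE ?expR_ge0// (_ : 2 = 2%:R * 1 :> R); last by ring.
    rewrite expRM_natl (_ : 4 = 2 ^+ 2); last by rewrite -natrX.
    by rewrite lerXn2r ?nnegrE ?expR_ge0 ?two_le_expR1.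
  rewrite -expRM_natl ler_expR.
  by move: ht; rewrite -mulrA -/N -/x; lra.
have hr : (1 - r / 2) ^+ (n + c).-1 <= expR (- (x * y / 4)).
  apply: (@le_trans _ _ (expR (- (r / 2)) ^+ (n + c).-1)).
    rewrite lerXn2r ?nnegrE ?expR_ge0//; first by lra.
    by have := expR_ge1Dx (- (r / 2)); lra.
  rewrite -expRM_natl ler_expR.
  have xy : x * y = r * N by rewrite NE /y; ring.
  rewrite xy mulrN lerN2.
  have : N <= 2 * (n + c).-1%:R.
    rewrite /N -natrM ler_nat.
    have : (0 < c)%N by rewrite -(ltr0n R).
    by move: n0; clear; lia.
  move=> /(ler_wpM2l (ltW r0)); lra.
have step : 2 * (m + c)%:R ^+ 2 * N * (4 ^+ t * (1 - r / 2) ^+ (n + c).-1) <=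
    2 * (expR L * N) ^+ 2 * N * (expR (6 * x) * expR (- (x * y / 4))).
  have N0 : 0 <= N by rewrite /N.
  have p0 : 0 <= (1 - r / 2) ^+ (n + c).-1 by rewrite exprn_ge0//; lra.
  apply: ler_pM.
  - by rewrite !mulr_ge0// exprn_ge0.
  - by rewrite mulr_ge0// exprn_ge0.
  - by rewrite ler_wpM2r// ler_wpM2l// lerXn2r ?nnegrE ?mulr_ge0 ?expR_ge0.
  - by apply: ler_pM => //; rewrite exprn_ge0.
apply: (le_trans step).
(* Of the factor [c^3], one [c] is the target and the other two become [y e^l]. *)
have -> : 2 * (expR L * N) ^+ 2 * N * (expR (6 * x) * expR (- (x * y / 4))) =
   c%:R * (2 * x ^+ 3 * y ^+ 2 *
     (expR L ^+ 2 * expR l ^+ 2 * expR (6 * x) * expR (- (x * y / 4)))).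
  rewrite NE [in LHS]exprMn [in LHS]exprMn.
  rewrite (_ : c%:R ^+ 2 = y ^+ 2 * expR l ^+ 2); last by rewrite hcl exprMn.
  by ring.
rewrite ger_pMr//.
apply: (@le_trans _ _ (expR (11 + 3 * x + y / 16) *
     (expR L ^+ 2 * expR l ^+ 2 * expR (6 * x) * expR (- (x * y / 4))))).
  by rewrite ler_wpM2r ?poly_le_expR// !mulr_ge0// ?exprn_ge0 ?expR_ge0.
rewrite -!expRM_natl -!expRD -[leRHS]expR0 ler_expR.
(* This bounds [x y] below by [128 x + y - 128], so that the comparison of exponents becomes linear
   and follows from [y_ge]. *)
have : 0 <= (x - 1) * (y - 128) by rewrite mulr_ge0//; lra.
by lra.
Qed.

(** From [ln r <= r - 1] comes [1 <= r + l], which absorbs the isolated [1 / r] into [1 + l / r].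
    The summand 4 leaves room for rounding. *)
Lemma augmentation_size (L l r : R) : 0 <= L -> 0 < r <= 1 -> l = ln r^-1 ->
  128 * (1 + L + l) / r + 4 <= 264 * (1 + (L + l) / r).
Proof.
move=> L0 /andP[r0 r1] lE.
have : ln r <= r - 1.
  have := @le_ln1Dx _ (r - 1); rewrite (_ : 1 + (r - 1) = r); last by ring.
  by apply; lra.
have -> : ln r = - l by rewrite lE lnV ?opprK// posrE.
move=> hl; have rn0 : r != 0 by rewrite gt_eqF.
rewrite -(ler_pM2r r0).
have -> : (128 * (1 + L + l) / r + 4) * r = 128 * (1 + L + l) + 4 * r by field.
have -> : 264 * (1 + (L + l) / r) * r = 264 * (r + L + l) by field.
by lra.
Qed.
End Estimates.

(** * Choice of [K], [c] and [t] *)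

Theorem theorem1p3 (R : realType) :
  exists K : R, 0 < K /\
  forall (m n : nat) (FB FS : probability R R),
    (1 <= n)%N -> (n <= m)%N ->
    (0 < prob_b_ge_s FB FS < 1)%E ->
    let r := fine (prob_b_ge_s FB FS) in
    exists c : nat,
      (c%:R <= K * (1 + (ln (m%:R / n%:R) + ln (r^-1)) / r)) /\
      (OPT FB FS m n <= STR FB FS (m + c) (n + c))%E.
Proof.
exists 264; split=> [|m n FB FS n0 nm /andP[p0 p1] r]; first by rewrite ltr0n.
have rE : prob_b_ge_s FB FS = r%:E.
  by rewrite fineK// ge0_fin_numE ?ltW// (lt_trans p1)// ltey.
move: p0 p1; rewrite rE !lte_fin => r0 r1.
have r01 : 0 < r <= 1 by rewrite r0 ltW.
set L := ln (m%:R / n%:R); set l := ln r^-1.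
have L0 : 0 <= L.
  by apply: ln_ge0; rewrite ler_pdivlMr ?mul1r ?ler_nat// ltr0n.
have l0 : 0 <= l by apply: ln_ge0; rewrite invf_ge1// ltW.
pose z := 128 * (1 + L + l) / r.
have z128 : 128 <= z by rewrite ler_pdivlMr//; lra.
have z0 : 0 <= z by lra.
(* Rounding up keeps [z <= c <= z + 1], within the slack of [augmentation_size]. *)
pose c := (Num.trunc z).+1.
have /andP[c_le z_lt] := truncn_itv z0.
have zc : z <= c%:R by exact: ltW.
exists c; split.
  apply: le_trans (augmentation_size L0 r01 (erefl l)).
  by rewrite /c -natr1 -/z; lra.
have c128 : (128 <= c)%N by rewrite -(ler_nat R) (le_trans z128).
have c0 : 0 < c%:R :> R by rewrite ltr0n.
(* Just above [2 N / c]: this gives both [2 N <= c t] and [t <= 2 N / c + 1]. *)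
pose t := (2 * (n + c) %/ c).+1.
have N3 : (3 < n + c)%N by rewrite (leq_trans _ (leq_addl n c))// (leq_trans _ c128).
have c_gt0 : (0 < c)%N by [].
have Nct : (2 * (n + c) <= c * t)%N by rewrite [leqRHS]mulnC /t ltnW// ltn_ceil.
apply: (OPT_le_STR n0 nm N3 c_gt0 Nct r01 rE).
apply: augmentation_suffices => //.
by rewrite /t -natr1 lerD2r ler_pdivlMr// -!natrM ler_nat leq_trunc_div.
Qed.
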